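(* Let $p\ge 1$, let $\mathbb{P}$ be a joint distribution of random variables $(X_1,\dots,X_p)$ that is a positive measure, and let $G^*$ be a DAG on the vertex set $[p]$ such that $\mathbb{P}$ is Markov to $G^*$. Then every DAG $G_{SP}$ output by the SP algorithm (run with the true conditional independence relations of $\mathbb{P}$) satisfies $G_{SP}\in\mathcal{M}(G^* )$ if and only if the pair $(G^*,\mathbb{P})$ satisfies the sparsest Markov representation (SMR) assumption.
   Context: $[p]=\{1,\dots,p\}$. A DAG $G=([p],E)$ is a directed acyclic graph with directed edge set $E$; $|G|$ is its number of edges. $\mathbb{P}$ is Markov to $G$ (equivalently, $(G,\mathbb{P})$ satisfies the Markov property) if whenever $j\neq k$ are d-separated in $G$ given $S\subset[p]\setminus\{j,k\}$, $X_j\perp X_k\mid X_S$ holds in $\mathbb{P}$, and likewise for d-separation of disjoint sets of vertices (equivalently, each $X_i$ is conditionally independent of its nondescendants that are not parents given its parents). ''Positive measure'' means that $\mathbb{P}$ has a strictly positive density with respect to a product measure. Two DAGs are Markov equivalent if they have the same d-separation statements; $\mathcal{M}(G)$ is the Markov equivalence class of $G$. SP (sparsest permutation) algorithm: for each permutation $\pi$ of $[p]$ define the DAG $G_\pi=([p],E_\pi)$ by: $(\pi(j),\pi(k))\in E_\pi$ if and only if $j<k$ and $X_{\pi(j)}$ and $X_{\pi(k)}$ are not conditionally independent given $X_{\{\pi(1),\dots,\pi(k-1)\}\setminus\{\pi(j)\}}$ in $\mathbb{P}$. The algorithm outputs all DAGs $G_{\pi^*}$ for which $|G_{\pi^*}|=\min_\pi|G_\pi|$;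 any such output DAG is denoted $G_{SP}$. SMR assumption: $(G^*,\mathbb{P})$ satisfies the Markov property and $|G|>|G^*|$ for every DAG $G$ on $[p]$ such that $(G,\mathbb{P})$ satisfies the Markov property and $G\notin\mathcal{M}(G^* )$. *)

(* Defs.v *)
From HB Require Import structures.
From mathcomp Require Import all_boot all_order all_algebra perm.
From mathcomp Require Import all_classical all_reals all_analysis.

Set Implicit Arguments.
Unset Strict Implicit.
Unset Printing Implicit Defensive.

Import Order.TTheory GRing.Theory Num.Theory.

Local Open Scope ring_scope.
Local Open Scope classical_set_scope.

Definition edge_rel (p : nat) (E : {set 'I_p * 'I_p}) : rel 'I_p :=
  fun x y => (x, y) \in E.

(* [cycle r c] says that the closed walk through the vertices of [c] follows
   [r]; loops and 2-cycles are the cases [size c = 1] and [size c = 2]. *)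
Definition acyclic (p : nat) (E : {set 'I_p * 'I_p}) : Prop :=
  forall c : seq 'I_p, cycle (edge_rel E) c -> c = [::].

Record dag (p : nat) : Type := Dag {
  edges : {set 'I_p * 'I_p};
  dag_acyclic : acyclic edges }.

Definition arc_in (p : nat) (G : dag p) : rel 'I_p := edge_rel (edges G).

Definition nb_edges (p : nat) (G : dag p) : nat := #|edges G|.

Definition adjacent (p : nat) (G : dag p) : rel 'I_p :=
  fun x y => arc_in G x y || arc_in G y x.

Definition collider (p : nat) (G : dag p) (x y z : 'I_p) : bool :=
  arc_in G x y && arc_in G z y.

(* The reflexive closure [connect] counts a vertex among its own descendants,
   so a collider is open when it, or one of its descendants, lies in [S]. *)
Definition open_triple (p : nat) (G : dag p) (S : {set 'I_p}) (x y z : 'I_p)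
    : bool :=
  if collider G x y z then [exists d in S, connect (arc_in G) y d]
  else y \notin S.

Fixpoint open_walk (p : nat) (G : dag p) (S : {set 'I_p}) (s : seq 'I_p)
    : bool :=
  match s with
  | x :: (y :: z :: _) as t => open_triple G S x y z && open_walk G S t
  | _ => true
  end.

Definition d_connected (p : nat) (G : dag p) (S : {set 'I_p}) (j k : 'I_p)
    : Prop :=
  exists s : seq 'I_p,
    [/\ path (adjacent G) j s, last j s = k, uniq (j :: s)
      & open_walk G S (j :: s)].

Definition d_separated (p : nat) (G : dag p) (A B S : {set 'I_p}) : Prop :=
  forall j k : 'I_p, j \in A -> k \in B -> ~ d_connected G S j k.

Definition pairwise_disjoint (p : nat) (A B S : {set 'I_p}) : Prop :=
  [/\ [disjoint A & B], [disjoint A & S] & [disjoint B & S]]%bool.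

Definition markov_equivalent (p : nat) (G H : dag p) : Prop :=
  forall A B S : {set 'I_p}, pairwise_disjoint A B S ->
    (d_separated G A B S <-> d_separated H A B S).

Definition markov_class (p : nat) (G : dag p) : set (dag p) :=
  [set H | markov_equivalent G H].

(* The i-th random variable is the i-th coordinate on the product of the state
   spaces [T i]; [coord_sets T S] generates the sigma-algebra of the variables
   with index in [S]. *)
Definition coord_sets (p : nat) (d : 'I_p -> measure_display)
    (T : forall i, measurableType (d i)) (S : {set 'I_p})
    : set (set (forall i, T i)) :=
  \bigcup_(i in [set` S])
    preimage_set_system setT (fun x : forall i, T i => x i) measurable.

Arguments coord_sets {p d} T S.

Definition coord_space (p : nat) (d : 'I_p -> measure_display)
    (T : forall i, measurableType (d i)) (S : {set 'I_p}) :=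
  g_sigma_algebraType (coord_sets T S).

Definition joint_space (p : nat) (d : 'I_p -> measure_display)
    (T : forall i, measurableType (d i)) :=
  coord_space T [set: 'I_p]%SET.

Definition is_product_measure (R : realType) (p : nat)
    (d : 'I_p -> measure_display) (T : forall i, measurableType (d i))
    (mu : forall i, set (T i) -> \bar R)
    (m : set (joint_space T) -> \bar R) : Prop :=
  forall A : forall i, set (T i), (forall i, measurable (A i)) ->
    m [set x | forall i, A i (x i)] = (\prod_(i < p) mu i (A i))%E.

Definition positive_measure (R : realType) (p : nat)
    (d : 'I_p -> measure_display) (T : forall i, measurableType (d i))
    (P : probability (joint_space T) R) : Prop :=
  exists (mu : forall i, {sigma_finite_measure set T i -> \bar R})
         (m : {measure set (joint_space T) -> \bar R})
         (f : joint_space T -> R),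
    [/\ is_product_measure mu m,
        measurable_fun setT f,
        (forall x, (0 < f x)%R)
      & forall A, measurable A -> P A = \int[m]_(x in A) (f x)%:E]%E.

(* [h] is a version of the conditional probability P(E | X_S). *)
Definition is_cond_prob (R : realType) (p : nat)
    (d : 'I_p -> measure_display) (T : forall i, measurableType (d i))
    (P : probability (joint_space T) R) (S : {set 'I_p})
    (E : set (joint_space T)) (h : joint_space T -> R) : Prop :=
  [/\ measurable_fun setT (h : coord_space T S -> R),
      P.-integrable setT (EFin \o h)
    & forall C : set (coord_space T S), measurable C ->
        \int[P]_(x in (C : set (joint_space T))) (h x)%:E = P (C `&` E)]%E.

(* X_A and X_B are conditionally independent given X_S:
   P(E `&` F | X_S) = P(E | X_S) P(F | X_S) almost surely for all events E of
   sigma(X_A) and F of sigma(X_B). As versions of a conditional probability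
   are unique up to null sets, this says that the product of versions of the
   two factors is a version of the left-hand side. *)
Definition cond_indep (R : realType) (p : nat)
    (d : 'I_p -> measure_display) (T : forall i, measurableType (d i))
    (P : probability (joint_space T) R) (A B S : {set 'I_p}) : Prop :=
  forall (E : set (coord_space T A)) (F : set (coord_space T B)),
    measurable E -> measurable F ->
    exists e f : joint_space T -> R,
      [/\ is_cond_prob P S E e, is_cond_prob P S F f
        & is_cond_prob P S (E `&` F) (e \* f)%R].

Definition markov_to (R : realType) (p : nat)
    (d : 'I_p -> measure_display) (T : forall i, measurableType (d i))
    (G : dag p) (P : probability (joint_space T) R) : Prop :=
  forall A B S : {set 'I_p}, pairwise_disjoint A B S ->
    d_separated G A B S -> cond_indep P A B S.

Definition predecessors (p : nat) (pi : {perm 'I_p}) (k : 'I_p)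
    : {set 'I_p} :=
  [set pi i | i : 'I_p & (i < k)%N]%SET.

Definition perm_edges (R : realType) (p : nat)
    (d : 'I_p -> measure_display) (T : forall i, measurableType (d i))
    (P : probability (joint_space T) R) (pi : {perm 'I_p})
    : {set 'I_p * 'I_p} :=
  [set (pi jk.1, pi jk.2) | jk : 'I_p * 'I_p &
     (jk.1 < jk.2)%N &&
     `[< ~ cond_indep P [set pi jk.1]%SET [set pi jk.2]%SET
             (predecessors pi jk.2 :\ pi jk.1)%SET >]]%SET.

Lemma perm_edges_acyclic (R : realType) (p : nat)
    (d : 'I_p -> measure_display) (T : forall i, measurableType (d i))
    (P : probability (joint_space T) R) (pi : {perm 'I_p}) :
  acyclic (perm_edges P pi).
Proof.
pose r : rel 'I_p := fun x y => ((pi^-1)%g x < (pi^-1)%g y)%N.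
have sub : subrel (edge_rel (perm_edges P pi)) r.
  move=> x y /imsetP[[j k]]; rewrite inE /= => /andP[jk _] [-> ->].
  by rewrite /r !permK.
have r_trans : transitive r by move=> y x z; apply: ltn_trans.
case=> [//|x c]; rewrite /cycle => /(sub_path sub).
move=> /(order_path_min r_trans)/allP/(_ x).
by rewrite mem_rcons mem_head => /(_ isT); rewrite /r ltnn.
Qed.

Definition perm_dag (R : realType) (p : nat)
    (d : 'I_p -> measure_display) (T : forall i, measurableType (d i))
    (P : probability (joint_space T) R) (pi : {perm 'I_p}) : dag p :=
  Dag (@perm_edges_acyclic _ _ _ _ P pi).

Definition sp_output (R : realType) (p : nat)
    (d : 'I_p -> measure_display) (T : forall i, measurableType (d i))
    (P : probability (joint_space T) R) : set (dag p) :=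
  [set perm_dag P pi | pi in
     [set pi | forall pi' : {perm 'I_p},
        (nb_edges (perm_dag P pi) <= nb_edges (perm_dag P pi'))%N]].

Definition SMR (R : realType) (p : nat)
    (d : 'I_p -> measure_display) (T : forall i, measurableType (d i))
    (Gstar : dag p) (P : probability (joint_space T) R) : Prop :=
  markov_to Gstar P /\
  forall G : dag p, markov_to G P -> ~ markov_class Gstar G ->
    (nb_edges Gstar < nb_edges G)%N.

(* Main.v *)
From HB Require Import structures.
Require Import Defs.
From mathcomp Require Import all_boot all_order all_algebra perm.
From mathcomp Require Import all_classical all_reals all_analysis.
From mathcomp Require Import measurable_realfun.
(* imported again so that [adjacent] denotes adjacency in a DAG *)
Import Defs.

Set Implicit Arguments.
Unset Strict Implicit.
Unset Printing Implicit Defensive.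

(** The sparsest permutation DAGs are the sparsest DAGs to which [P] is Markov,
    and Markov equivalent DAGs have equally many edges; the equivalence with SMR
    is then a comparison of edge counts.  Three facts carry this.

    If [P] is Markov to [G] and [pi] lists the vertices in a topological order of
    [G], then [G_pi] is a subgraph of [G] ([perm_dag_sub_markov]): a vertex [x]
    and a later vertex [y] not joined by an arc are d-separated by the other
    predecessors of [y] ([nonadjacent_separated]), hence conditionally
    independent given them.  So the minimum over permutations is at most the
    size of every Markov DAG, and a Markov DAG that attains it is itself some
    [G_pi], that is, an output of the algorithm.

    The same d-separation shows that two vertices are adjacent exactly when no
    set separates them, so that the skeleton, and with it the number of edges, is
    an invariant of Markov equivalence ([markov_equivalent_nb_edges]).

    Finally [P] is Markov to every [G_pi] ([perm_dag_markov]); this is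
    where the positivity of [P] enters.  The non-arcs of [G_pi] are pairwise
    statements [x _||_ y | pred(y) \ x].  Conditional independence is a
    semi-graphoid ([cond_indep_semi_graphoid]), and for positive [P] it also satisfies the
    intersection axiom ([cond_indep_intersection]), which merges the pairwise
    statements at [y] into the local statement that [y] is independent of its
    nonparents among its predecessors given its parents
    ([perm_dag_nonparents]).  That the semi-graphoid axioms derive all
    d-separations from these local statements is the theorem of Verma and Pearl
    ([global_markov]), proved by induction on the last vertex involved.

    For the probabilistic part, [A _||_ B | S] is first restated as: conditional
    probabilities of events of [A] given [S] are also conditional probabilities
    given [S] and [B] ([cond_indepP]).  The semi-graphoid axioms follow at once.
    For the intersection axiom, one has a function of the coordinates [S, C] that
    agrees almost everywhere with a function of the coordinates [S, j]; since
    [P] has the null sets of a product measure, Fubini's theorem lets one freeze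
    the coordinate [j] at a suitable value without losing the agreement, which
    leaves a function of the coordinates [S] alone ([positive_null_resample]). *)

Section Graphs.
Import fintype boot.finset.

(** * Open walks and d-connection *)

Section Walks.
Variables (p : nat) (G : dag p).
Implicit Types (S A B : {set 'I_p}) (x y z u v w : 'I_p) (s t : seq 'I_p).

Lemma adjacent_sym : symmetric (adjacent G).
Proof. by move=> x y; rewrite /adjacent orbC. Qed.

Lemma open_triple_sym S x y z : open_triple G S x y z = open_triple G S z y x.
Proof. by rewrite /open_triple /collider andbC. Qed.

Lemma open_walk_cons3 S x y z s : open_walk G S [:: x, y, z & s] =
  open_triple G S x y z && open_walk G S [:: y, z & s].
Proof. by []. Qed.

Lemma open_walk_split S s x y t :
  open_walk G S (s ++ [:: x, y & t]) =
  open_walk G S (s ++ [:: x; y]) && open_walk G S [:: x, y & t].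
Proof.
elim: s => [//|a s IHs].
case: s IHs => [|b s] IHs; first by rewrite /= andbT.
by case: s IHs => [|c s] IHs; rewrite !cat_cons ?cat0s !open_walk_cons3 -andbA; congr (_ && _).
Qed.

Lemma open_walk_catr S s t : open_walk G S (s ++ t) -> open_walk G S t.
Proof.
case: t => [//|x [//|y t]].
by rewrite open_walk_split => /andP[].
Qed.

Lemma open_walk_rev S s : open_walk G S (rev s) = open_walk G S s.
Proof.
elim: s => [//|x [//|y [//|z t]] IHs].
rewrite !rev_cons -!cats1 -!catA /= open_walk_split /= andbT open_triple_sym.
rewrite andbC; congr (_ && _); rewrite -[RHS]IHs.
by rewrite !rev_cons -!cats1 -!catA.
Qed.

Lemma open_walk_catl S s t : open_walk G S (s ++ t) -> open_walk G S s.
Proof.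
rewrite -open_walk_rev rev_cat => /open_walk_catr.
by rewrite open_walk_rev.
Qed.

(** The arcs point forward until the first collider; that collider is a
    descendant of [x], and being open it has a descendant in [S]. *)
Lemma out_walk_ends_forward S x y s v :
  arc_in G x y -> path (adjacent G) y (rcons s v) ->
  open_walk G S [:: x, y & rcons s v] ->
  [exists d in S, connect (arc_in G) x d] \/ arc_in G (last y s) v.
Proof.
elim: s x y => [|z s IHs] x y xy /=.
  rewrite !andbT /open_triple /collider xy /= => yv.
  case: ifPn => [_ /existsP[d /andP[dS yd]]|vy _].
    by left; apply/existsP; exists d; rewrite dS (connect_trans (connect1 xy)).
  by right; move: yv; rewrite /adjacent (negPf vy) orbF.
case/andP=> yz path_s /andP[].
rewrite {1}/open_triple /collider xy /=.
case: ifPn => [_ /existsP[d /andP[dS yd]] _|zy _ open_s].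
  by left; apply/existsP; exists d; rewrite dS (connect_trans (connect1 xy)).
have {}yz : arc_in G y z by move: yz; rewrite /adjacent (negPf zy) orbF.
case: (IHs _ _ yz path_s open_s) => [/existsP[d /andP[dS yd]]|]; last by right.
by left; apply/existsP; exists d; rewrite dS (connect_trans (connect1 xy)).
Qed.

(** Cutting out a closed detour [c] at [v] keeps the walk open at [v].  If [v] lies
    in [S], both old triples at [v] are colliders, hence so is the new one.  If
    the new triple is a collider while both old ones are not, then the detour
    starts and ends with arcs out of [v], so that [v] has a descendant in [S] by
    [out_walk_ends_forward]. *)
Lemma open_triple_cut S u v c w :
  path (adjacent G) u (v :: rcons c v) -> adjacent G v w ->
  open_walk G S (u :: v :: rcons c v ++ [:: w]) -> open_triple G S u v w.
Proof.
set u' := head v c => path_c vw open_c.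
have first_open : open_triple G S u v u'.
  by move: open_c; rewrite /u'; case: (c) => [|? [|? ?]] /= /andP[].
have last_open : open_triple G S (last v c) v w.
  move: open_c; case/lastP: (c) => [|c' w']; first by move=> /= /and3P[].
  rewrite last_rcons -!cats1 -!catA /= => open_c.
  have {}open_c : open_walk G S ([:: u, v & c'] ++ [:: w'; v; w]) by [].
  by have := open_walk_catr open_c => /= /andP[].
rewrite /open_triple; case: ifPn => [|new_nc]; last first.
  apply: contra new_nc => vS.
  move: first_open last_open; rewrite /open_triple vS /=.
  case: ifPn => // /andP[uv _] _; case: ifPn => // /andP[_ wv] _.
  by rewrite /collider uv.
case/andP=> uv wv.
have [u'v|u'v] := boolP (arc_in G u' v).
  by move: first_open; rewrite /open_triple /collider uv u'v.
have [w'v|w'v] := boolP (arc_in G (last v c) v).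
  by move: last_open; rewrite /open_triple /collider wv w'v.
case: c @u' path_c open_c u'v w'v {first_open last_open} => [|u' c] /=.
  by move=> /and3P[_ + _] _ vv; rewrite /adjacent (negPf vv).
move=> /and3P[_ vu' path_c] /andP[_ open_c] u'v w'v.
have {}vu' : arc_in G v u' by move: vu'; rewrite /adjacent (negPf u'v) orbF.
have {}open_c : open_walk G S [:: v, u' & rcons c v].
  by apply: (@open_walk_catl _ _ [:: w]); exact: open_c.
case: (out_walk_ends_forward vu' path_c open_c) => //.
by rewrite (negPf w'v).
Qed.

(** Unlike the paths of [d_connected], walks may revisit vertices, so that two of
    them can be joined end to end. *)
Definition walk_connected S j k :=
  exists s, [/\ path (adjacent G) j s, last j s = k & open_walk G S (j :: s)].

Lemma not_uniq_split s : ~~ uniq s ->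
  exists v a c t, s = a ++ v :: c ++ v :: t.
Proof.
elim: s => [//|x s IHs] /=; rewrite negb_and negbK.
case/orP=> [/splitPr[c t]|/IHs[v [a [c [t ->]]]]].
  by exists x, [::], c, t.
by exists v, (x :: a), c, t.
Qed.

(** Removing detours between two visits of a vertex shortens an open walk until it
    is a path. *)
Lemma walk_connectedP S j k : walk_connected S j k <-> d_connected G S j k.
Proof.
split=> [[s []]|[s [? ? _ ?]]]; last by exists s.
have [n] := ubnP (size s).
elim: n s => // n IHn s; rewrite ltnS => sn path_s last_s open_s.
have [uniq_s|/not_uniq_split[v [a [c [t]]]]] := boolP (uniq (j :: s)).
  by exists s.
case: a => [|i a] /= [eq_j eq_s]; subst.
  have path_t : path (adjacent G) v t.
    by move: path_s; rewrite cat_path /= => /and3P[].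
  apply: (IHn t) => //.
  - by move: sn; rewrite size_cat /=; apply: leq_trans; rewrite addnS ltnS leq_addl.
  - by rewrite last_cat.
  - by apply: (@open_walk_catr _ (v :: c)).
apply: (IHn (a ++ v :: t)) => //.
- apply: leq_trans sn; rewrite !(size_cat, size_cat, size_cat) /= size_cat /=.
  by rewrite -addnS leq_add2l ltnS addnS ltnS leq_addl.
- move: path_s; rewrite !cat_path /= !cat_path /= => /and3P[-> -> /=].
  by case/and3P.
- by rewrite !last_cat /= last_cat.
case: t {IHn} sn path_s open_s => [|w t] sn path_s open_s.
  rewrite -cat_cons; apply: (@open_walk_catl _ _ (c ++ [:: v])).
  by rewrite -catA.
case/lastP: a i {sn} path_s open_s => [|a u] i path_s open_s.
  have /andP[iv path_c] : adjacent G i v && path (adjacent G) v (c ++ v :: w :: t).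
    by [].
  move: path_c; rewrite cat_path /= => /and4P[path_c cv vw _].
  change (open_walk G S [:: i, v, w & t]); rewrite open_walk_cons3.
  rewrite (@open_walk_catr _ [:: i, v & c] (v :: w :: t)) ?andbT //.
  apply: (@open_triple_cut _ _ _ c) => //.
    by rewrite /= iv rcons_path path_c.
  apply: (@open_walk_catl _ _ t).
  by rewrite -cats1 /= -!catA.
move: path_s open_s; rewrite -cats1 -!catA /= => path_s open_s.
change (open_walk G S ((i :: a) ++ [:: u, v, w & t])).
rewrite open_walk_split.
apply/andP; split.
  apply: (@open_walk_catl _ _ (c ++ [:: v, w & t])).
  by rewrite -catA.
have {}open_s : open_walk G S [:: u, v & c ++ [:: v, w & t]].
  by apply: (@open_walk_catr _ (i :: a)); exact: open_s.
rewrite open_walk_cons3 (@open_walk_catr _ [:: u, v & c] (v :: w :: t)) ?andbT //.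
move: path_s; rewrite cat_path /= => /and4P[_ _ uv].
rewrite cat_path /= => /and4P[path_c cv vw _].
apply: (@open_triple_cut _ _ _ c) => //.
  by rewrite /= uv rcons_path path_c.
apply: (@open_walk_catl _ _ t).
by rewrite -cats1 /= -!catA.
Qed.

Lemma walk_connected_sym S j k : walk_connected S j k -> walk_connected S k j.
Proof.
case=> s [path_s last_s open_s].
exists (rev (belast j s)); split.
- rewrite -last_s rev_path.
  by under eq_path do rewrite adjacent_sym.
- by case: s {path_s open_s} last_s => [//|x s] _; rewrite /= rev_cons last_rcons.
- by rewrite -last_s -rev_rcons -lastI open_walk_rev.
Qed.

Lemma d_separated_sym A B S : d_separated G A B S -> d_separated G B A S.
Proof.
move=> sepAB j k jB kA /walk_connectedP/walk_connected_sym/walk_connectedP.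
exact: sepAB.
Qed.

Lemma adjacent_d_connected S j k : adjacent G j k -> d_connected G S j k.
Proof.
by move=> jk; apply/walk_connectedP; exists [:: k]; split=> //=; rewrite jk.
Qed.

End Walks.

(** * Walks in a ranked DAG *)

Section Ranked.
Variables (p : nat) (G : dag p) (rk : 'I_p -> nat).
Hypothesis rk_inj : injective rk.
Hypothesis rk_arc : forall x y, arc_in G x y -> rk x < rk y.
Implicit Types (S A B : {set 'I_p}) (x y z u v w : 'I_p) (s t : seq 'I_p).

Definition initial m : {set 'I_p} := [set x | rk x < m].
Definition parents y : {set 'I_p} := [set x | arc_in G x y].

Lemma rk_connect x y : connect (arc_in G) x y -> rk x <= rk y.
Proof.
case/connectP=> s path_s ->.
elim: s x path_s => [//|y' s IHs] x /= /andP[/rk_arc/ltnW xy /IHs].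
exact: leq_trans.
Qed.

(** Descendants of [y] have rank at least [m], so none is in [S] and no collider
    met by the walk outside [initial m] is open: it can only go forward. *)
Lemma escaping_walk m S x y s : S \subset initial m -> m <= rk y ->
  arc_in G x y -> path (adjacent G) y s -> open_walk G S [:: x, y & s] ->
  m <= rk (last y s).
Proof.
move=> Sm; elim: s x y => [//|z s IHs] x y my xy /= /andP[yz path_s] /andP[].
rewrite {1}/open_triple /collider xy /=; case: ifPn.
  move=> _ /existsP[d /andP[/(subsetP Sm)]]; rewrite inE => dm /rk_connect yd _.
  by have := leq_trans (leq_trans dm my) yd; rewrite ltnn.
move=> zy _ open_s; move: yz; rewrite /adjacent (negPf zy) orbF => yz.
apply: (IHs y z) => //.
exact: leq_trans my (ltnW (rk_arc yz)).
Qed.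

(** A walk leaving [initial m] does so along an arc, and then never comes back. *)
Lemma open_walk_initial m S x s : S \subset initial m ->
  path (adjacent G) x s -> open_walk G S (x :: s) ->
  rk x < m -> rk (last x s) < m -> all (fun z => rk z < m) (x :: s).
Proof.
move=> Sm; elim: s x => [|y s IHs] x /=; first by move=> _ _ ->.
case/andP=> xy path_s open_s xm lm; rewrite xm /=.
have open_ys : open_walk G S (y :: s) by apply: (@open_walk_catr _ _ _ [:: x]).
apply: IHs => //; rewrite ltnNge; apply/negP => my.
have {}xy : arc_in G x y.
  case/orP: xy => // /rk_arc yx.
  by have := leq_trans (leq_trans yx (ltnW xm)) my; rewrite ltnn.
by have := escaping_walk Sm my xy path_s open_s; rewrite leqNgt lm.
Qed.

(** A vertex of maximal rank on a walk can only be an endpoint or a collider, so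
    conditioning on it blocks nothing. *)
Lemma open_walk_add_top n S x s :
  path (adjacent G) x s -> all (fun z => rk z <= rk n) (x :: s) ->
  open_walk G S (x :: s) -> open_walk G (n |: S) (x :: s).
Proof.
elim: s x => [//|y [//|z s] IHs] x.
move=> /= /andP[xy path_s] /and4P[xn yn zn s_n] /andP[open_y open_s].
apply/andP; split; last by apply: IHs; rewrite // /= yn zn.
have /andP[yz _] := path_s.
move: open_y; rewrite /open_triple; case: ifPn.
  move=> _ /existsP[d /andP[dS yd]].
  by apply/existsP; exists d; rewrite yd in_setU1 dS orbT.
move=> nc yS; rewrite in_setU1 negb_or yS andbT.
apply: contra nc => /eqP eq_y; subst y.
have top u : adjacent G u n -> rk u <= rk n -> arc_in G u n.
  by case/orP=> // /rk_arc nu; rewrite leqNgt nu.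
by rewrite /collider !top // adjacent_sym.
Qed.

(** An open path from [x] to [y] stays among [y] and its predecessors, so all its
    interior vertices are in the conditioning set and must be colliders; but the
    last of them precedes [y], hence points to [y] and is not a collider. *)
Lemma nonadjacent_separated x y : rk x < rk y -> ~~ arc_in G x y ->
  d_separated G [set x] [set y] (initial (rk y) :\ x).
Proof.
move=> xy nxy j k /set1P-> /set1P-> [s [path_s last_s uniq_s open_s]].
have Sm : initial (rk y) :\ x \subset initial (rk y).+1.
  by apply/subsetP=> z; rewrite !inE => /andP[_ /ltnW]; rewrite ltnS.
have := open_walk_initial Sm path_s open_s (ltnW xy).
rewrite last_s => /(_ (ltnSn _)) all_s.
case/lastP: s path_s last_s uniq_s open_s all_s => [|s y'].
  by move=> _ /= eq_xy; move: xy; rewrite eq_xy ltnn.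
rewrite last_rcons => + eq_y; subst y'; case/lastP: s => [|s u].
  move=> /=; rewrite andbT => /orP[|/rk_arc yx]; first by rewrite (negPf nxy).
  by move: (ltn_trans xy yx); rewrite ltnn.
rewrite -!cats1 -catA /= => path_s uniq_s open_s /andP[_ all_s].
have {uniq_s} [ux uy] : u != x /\ u != y.
  move: uniq_s; rewrite mem_cat !inE !negb_or cat_uniq /= !inE.
  by rewrite eq_sym => /and5P[/and3P[_ -> _] _ _ ->].
have urk : rk u < rk y.
  move: all_s; rewrite all_cat /= => /and3P[_ + _].
  by rewrite ltnS leq_eqVlt (inj_eq rk_inj) (negPf uy).
case/lastP: s path_s open_s {all_s} => [|s t].
  move=> _ /= /andP[].
  rewrite /open_triple /collider !inE ux urk /=.
  case: ifPn => // /andP[_ /rk_arc yu].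
  by move: (ltn_trans yu urk); rewrite ltnn.
rewrite -cats1 -catA /= => _ open_s.
have {open_s} : open_walk G (initial (rk y) :\ x) ([:: x & s] ++ [:: t; u; y]).
  by [].
move=> /open_walk_catr /= /andP[].
rewrite /open_triple /collider !inE ux urk /=.
case: ifPn => // /andP[_ /rk_arc yu].
by move: (ltn_trans yu urk); rewrite ltnn.
Qed.

End Ranked.

(** * Topological orders *)

Section Topological.
Variables (p : nat) (G : dag p).

Lemma arc_connect_back x y : arc_in G x y -> ~~ connect (arc_in G) y x.
Proof.
move=> xy; apply/negP => /connectP[s path_s last_s].
have := @dag_acyclic _ G (y :: s).
rewrite (cycle_path x) /= -last_s; rewrite -[edge_rel _]/(arc_in G) xy.
by move=> /(_ path_s).
Qed.

(** Sort by the number of ancestors, which grows strictly along arcs. *)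
Lemma topological_perm :
  exists pi : {perm 'I_p}, forall x y, arc_in G x y -> (pi^-1)%g x < (pi^-1)%g y.
Proof.
pose anc x := #|[set z | connect (arc_in G) z x]|.
pose key x := anc x * p + x.
have keyP x y : arc_in G x y -> key x < key y.
  move=> xy; have : anc x < anc y.
    apply: proper_card; apply/properP; split.
      apply/subsetP => z; rewrite !inE => zx.
      exact: connect_trans zx (connect1 xy).
    by exists y; rewrite inE ?connect0 // arc_connect_back.
  rewrite /key -(@leq_pmul2r p) ?(leq_ltn_trans _ (ltn_ord x)) //.
  move=> le_xy; rewrite (@leq_trans ((anc x).+1 * p)) //.
    by rewrite mulSn addnC ltn_add2r ltn_ord.
  exact: leq_trans le_xy (leq_addr _ _).
have key_inj : injective key.
  move=> x y /(congr1 (modn^~ p)).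
  by rewrite /key !modnMDl !modn_small // => /val_inj.
pose low x := [set z | key z < key x].
have low_lt x : #|low x| < p.
  rewrite -[X in _ < X]card_ord; apply: proper_card; apply/properP.
  by split; [exact/subset_predT | exists x; rewrite // inE ltnn].
have low_mono x y : key x < key y -> #|low x| < #|low y|.
  move=> xy; apply: proper_card; apply/properP; split.
    by apply/subsetP => z; rewrite !inE => /ltn_trans; apply.
  by exists x; rewrite inE ?ltnn.
pose sigma x := Ordinal (low_lt x).
have sigma_inj : injective sigma.
  move=> x y /(congr1 val) /= eq_xy; apply: key_inj.
  by case: (ltngtP (key x) (key y)) => // /low_mono; rewrite eq_xy ltnn.
exists (perm sigma_inj)^-1%g => x y xy.
by rewrite invgK !permE /=; apply/low_mono/keyP.
Qed.

End Topological.

(** * Markov equivalent DAGs have the same skeleton *)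

Section Skeleton.
Variables (p : nat).
Implicit Types (G H : dag p).

(** Adjacent vertices are never d-separated, whereas nonadjacent ones are separated
    by some set: d-separation determines adjacency. *)
Lemma markov_equivalent_adjacent G H x y : markov_equivalent G H ->
  adjacent H x y -> adjacent G x y.
Proof.
move=> eqGH Hxy.
have [pi piP] := topological_perm G.
pose rk x := val ((pi^-1)%g x).
have rk_inj : injective rk by move=> u v /val_inj/perm_inj.
have Hirr u : ~~ adjacent H u u.
  rewrite /adjacent orbb; apply/negP => uu.
  by have := arc_connect_back uu; rewrite connect0.
wlog xy : x y Hxy / rk x < rk y.
  move=> wlog_xy; case: (ltngtP (rk x) (rk y)) => [||/rk_inj eq_xy].
  - exact: wlog_xy.
  - by rewrite adjacent_sym; apply: wlog_xy; rewrite adjacent_sym.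
  - by move: (Hirr x); rewrite {2}eq_xy Hxy.
apply/orP; left; apply/negP => /negP nxy.
have sepG := nonadjacent_separated rk_inj piP xy nxy.
have disj : pairwise_disjoint [set x] [set y] (initial rk (rk y) :\ x).
  split; rewrite disjoints1 !inE ?ltnn ?andbF ?eqxx //.
  by apply: contraL xy => /eqP->; rewrite ltnn.
have /(eqGH _ _ _ disj) sepH := sepG.
by apply: (sepH x y (set11 x) (set11 y)); apply: adjacent_d_connected.
Qed.

Lemma nb_edges_adjacent G :
  #|[set xy : 'I_p * 'I_p | adjacent G xy.1 xy.2]| = (nb_edges G).*2.
Proof.
pose flip (xy : 'I_p * 'I_p) := (xy.2, xy.1).
have flip_inj : injective flip by move=> [a b] [c d] [-> ->].
have -> : [set xy : 'I_p * 'I_p | adjacent G xy.1 xy.2] =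
    edges G :|: flip @: edges G.
  apply/setP => -[x y]; rewrite !inE /adjacent /= /arc_in /edge_rel.
  congr (_ || _); apply/idP/imsetP => [yx|[[a b] ab [-> ->]]] //.
  by exists (y, x).
rewrite cardsU card_imset // addnn.
suff -> : edges G :&: flip @: edges G = set0 by rewrite cards0 subn0.
apply/setP => -[x y]; rewrite !inE; apply/negP => /andP[xy /imsetP[[a b] ab]].
case=> eq_x eq_y; subst.
by have := arc_connect_back (xy : arc_in G b a); rewrite connect1.
Qed.

Lemma markov_equivalent_nb_edges G H : markov_equivalent G H ->
  nb_edges G = nb_edges H.
Proof.
move=> eqGH; apply: double_inj; rewrite -!nb_edges_adjacent.
apply: eq_card => -[x y]; rewrite !inE /=.
apply/idP/idP; apply: markov_equivalent_adjacent => //.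
by move=> A B S dABS; apply: iff_sym; exact: eqGH.
Qed.

End Skeleton.

(** * From local to global Markov properties *)

(** The axioms of Dawid and Pearl for an abstract conditional independence. *)
Record semi_graphoid (p : nat) (I : {set 'I_p} -> {set 'I_p} -> {set 'I_p} -> Prop)
    : Prop := SemiGraphoid {
  sg_empty : forall A S : {set 'I_p}, I A set0 S;
  sg_sym : forall A B S : {set 'I_p}, I A B S -> I B A S;
  sg_decomp : forall A B B' S : {set 'I_p}, B' \subset B -> I A B S -> I A B' S;
  sg_weak_union : forall A B C S : {set 'I_p},
    I A (B :|: C) S -> I A B (S :|: C);
  sg_contraction : forall A B C S : {set 'I_p},
    I A B S -> I A C (S :|: B) -> I A (B :|: C) S }.

Section GlobalMarkov.
Variables (p : nat) (G : dag p) (rk : 'I_p -> nat).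
Hypothesis rk_inj : injective rk.
Hypothesis rk_arc : forall x y, arc_in G x y -> rk x < rk y.
Variable I : {set 'I_p} -> {set 'I_p} -> {set 'I_p} -> Prop.
Hypothesis sgI : semi_graphoid I.
Hypothesis local_markov : forall y,
  I [set y] (initial rk (rk y) :\: parents G y) (parents G y).
Implicit Types (S A B : {set 'I_p}) (x y z u v w : 'I_p) (s t : seq 'I_p).

(** The induction hypothesis of the proof of [global_markov].  Separation is always
    taken in the whole DAG: by [open_walk_initial] this is the same as separation
    in the subgraph of the vertices of rank below [m]. *)
Let global_below m := forall A B S, A \subset initial rk m ->
  B \subset initial rk m -> S \subset initial rk m ->
  [disjoint A & S] -> [disjoint B & S] -> d_separated G A B S -> I A B S.

(** The walk may be prolonged at [r] since it leaves [r] through an arc out of [r],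
    so that [r] is not a collider. *)
Lemma parents_connected n r b S : arc_in G r n -> r \notin S ->
  d_connected G S r b -> d_connected G S n b.
Proof.
move=> rn rS /walk_connectedP[s [path_s last_s open_s]].
apply/walk_connectedP; exists (r :: s); split=> //.
  rewrite /=; by rewrite path_s adjacent_sym /adjacent rn.
case: s open_s {path_s last_s} => [//|z s] open_s.
rewrite open_walk_cons3 open_s andbT.
have /negPf nr : ~~ arc_in G n r.
  by apply/negP => /rk_arc nr; move: (ltn_trans nr (rk_arc rn)); rewrite ltnn.
by rewrite /open_triple /collider nr.
Qed.

(** A new last vertex [n] enters the left-hand set.  The parents of [n] outside [S]
    are separated from [B] together with [A], because [n] is reached through them;
    so the induction hypothesis gives [B _||_ A, pa(n) | S].  Given [S], [A] and
    [pa(n)], the vertex [n] is independent of [B] by the local property, and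
    contraction combines the two. *)
Lemma global_markov_add n A B S : global_below (rk n) ->
  A \subset initial rk (rk n) -> B \subset initial rk (rk n) ->
  S \subset initial rk (rk n) ->
  [disjoint A & S] -> [disjoint B & S] -> d_separated G (n |: A) B S ->
  I (n |: A) B S.
Proof.
move=> IHn An Bn Sn dAS dBS sepAB.
pose pa := parents G n; pose Z := A :|: (pa :\: S).
have pan : pa \subset initial rk (rk n).
  by apply/subsetP => x; rewrite !inE => /rk_arc.
have Zn : Z \subset initial rk (rk n).
  by rewrite subUset An (subset_trans _ pan) // subDset subsetUr.
have dZS : [disjoint Z & S].
  rewrite disjoint_subset; apply/subsetP => x; rewrite !inE.
  by case/orP=> [|/andP[]//]; apply: contraL => xS; rewrite (disjointFl dAS).
have sepZB : d_separated G Z B S.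
  move=> r b; rewrite !inE => /orP[rA|/andP[rS rn]] bB.
    by apply: sepAB => //; rewrite setU1r.
  by move/(parents_connected rn rS); apply: sepAB => //; rewrite setU11.
have dBpa x : x \in B -> x \notin pa.
  move=> xB; apply/negP; rewrite inE => xn.
  apply: (sepAB n x) => //; first by rewrite setU11.
  by apply: adjacent_d_connected; rewrite /adjacent xn orbT.
have paZS : pa \subset S :|: Z.
  by apply/subsetP => x xpa; rewrite !inE; move: xpa; rewrite inE => ->;
     case: (x \in S); rewrite ?orbT.
have IZB : I B Z S by apply: (sg_sym sgI); apply: IHn.
have InB : I B [set n] (S :|: Z).
  apply: (sg_sym sgI).
  have -> : S :|: Z = pa :|: ((S :|: Z) :\: pa).
    apply/setP => x; rewrite [in RHS]in_setU in_setD.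
    by case: (boolP (x \in pa)) => //= /(subsetP paZS).
  apply: (sg_weak_union sgI); apply: (sg_decomp sgI) (local_markov n).
  rewrite subUset; apply/andP; split; apply/subsetP => x.
    by move=> xB; rewrite in_setD dBpa //= (subsetP Bn).
  rewrite !in_setD => /andP[-> /=]; apply: subsetP.
  by rewrite subUset Sn.
apply: (sg_sym sgI); apply: (sg_decomp sgI) (sg_contraction sgI IZB InB).
by apply/subsetP => x; rewrite !inE => /orP[->|->]; rewrite ?orbT.
Qed.

(** Otherwise open walks from [A] and from [B] meet at [n], which both enter by an
    arc, and conditioning on the collider [n] opens their concatenation. *)
Lemma separated_or n A B S : n \notin A -> n \notin B ->
  A \subset initial rk (rk n).+1 -> B \subset initial rk (rk n).+1 ->
  S \subset initial rk (rk n).+1 ->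
  d_separated G A B (n |: S) ->
  d_separated G A [set n] S \/ d_separated G B [set n] S.
Proof.
move=> nA nB An Bn Sn sepAB; apply: contrapT => /not_orP[].
have conn C : ~ d_separated G C [set n] S -> exists2 a, a \in C & d_connected G S a n.
  move=> nsep; apply: contrapT => nex; apply: nsep => a k aC /set1P-> an.
  by apply: nex; exists a.
move=> /conn[a aA /walk_connectedP[s [path_s last_s open_s]]].
move=> /conn[b bB /walk_connectedP/walk_connected_sym[t [path_t last_t open_t]]].
have an := subsetP An _ aA; have bn := subsetP Bn _ bB.
rewrite inE in an; rewrite inE in bn.
apply: (sepAB a b) => //; apply/walk_connectedP; exists (s ++ t).
have all_s : all (fun z => rk z <= rk n) (a :: s).
  by apply: (open_walk_initial rk_arc Sn) => //; rewrite last_s ltnSn.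
have {}open_s := open_walk_add_top rk_arc path_s all_s open_s.
have all_t : all (fun z => rk z <= rk n) (n :: t).
  by apply: (open_walk_initial rk_arc Sn) => //; rewrite last_t.
have {}open_t := open_walk_add_top rk_arc path_t all_t open_t.
split; rewrite ?cat_path ?last_cat ?path_s ?last_s //.
case: t path_t last_t open_t all_t => [|w t] path_t last_t open_t all_t.
  by move: last_t nB => /= ->; rewrite bB.
case/lastP: s path_s last_s open_s all_s => [|s n'] path_s last_s open_s all_s.
  by move: last_s nA => /= <-; rewrite aA.
move: last_s path_s open_s all_s; rewrite last_rcons => ->.
rewrite rcons_path -!rcons_cons lastI all_rcons all_rcons.
move=> /andP[_ un] open_s /and3P[_ u_le _].
have collide x : adjacent G x n -> rk x <= rk n -> arc_in G x n.
  by case/orP=> // /rk_arc nx; rewrite leqNgt nx.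
have -> : a :: rcons s n ++ w :: t = belast a s ++ [:: last a s, n, w & t].
  by rewrite cat_rcons -[LHS]/((a :: s) ++ [:: n, w & t]) lastI cat_rcons.
move: open_s; rewrite -!cats1 -catA => open_s.
rewrite open_walk_split open_s open_walk_cons3 open_t andbT.
have [/andP[nw _] /and3P[_ w_le _]] := (path_t, all_t).
rewrite /open_triple /collider !collide // 1?adjacent_sym //=.
by apply/existsP; exists n; rewrite setU11 connect0.
Qed.

Lemma subset_initialS m n A : rk n = m -> n \notin A ->
  A \subset initial rk m.+1 -> A \subset initial rk m.
Proof.
move=> rkn nA /subsetP Am; apply/subsetP => x xA.
have := Am x xA; rewrite !inE ltnS leq_eqVlt => /orP[|//].
rewrite -rkn (inj_eq rk_inj) => /eqP eq_x; by rewrite -eq_x xA in nA.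
Qed.

(** Let [n] be the vertex of rank [m].  If it belongs to [A] or [B], use
    [global_markov_add].  If it belongs to [S], then [A] and [B] are already
    separated by [S] without [n], and by [separated_or] one of them, say [B], is
    separated from [n]; then [B _||_ A, n | S \ n], and weak union moves [n] into
    the conditioning set. *)
Lemma global_below_all m : global_below m.
Proof.
elim: m => [|m IHm] A B S Am Bm Sm dAS dBS sepAB.
  have -> : B = set0.
    by apply/setP => x; rewrite inE; apply/negP => /(subsetP Bm); rewrite inE.
  exact: (sg_empty sgI).
have [n /eqP rkn|no_n] := pickP (fun x => rk x == m); last first.
  have low (C : {set 'I_p}) : C \subset initial rk m.+1 -> C \subset initial rk m.
    move=> /subsetP Cm; apply/subsetP => x /Cm.
    by rewrite !inE ltnS leq_eqVlt no_n.
  by apply: IHm; rewrite ?low.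
subst m.
have add A' B' S' : A' \subset initial rk (rk n).+1 ->
    B' \subset initial rk (rk n).+1 -> S' \subset initial rk (rk n).+1 ->
    [disjoint A' & S'] -> [disjoint B' & S'] -> n \in A' ->
    d_separated G A' B' S' -> I A' B' S'.
  move=> A'm B'm S'm dA' dB' nA' sep'.
  have nB' : n \notin B'.
    apply/negP => nB'; apply: (sep' n n nA' nB').
    by exists [::].
  have nS' : n \notin S' by rewrite (disjointFr dA').
  rewrite -(setD1K nA'); apply: global_markov_add => //.
  - by apply: (subset_initialS erefl); rewrite ?setD11 // (subset_trans _ A'm) // subD1set.
  - exact: (subset_initialS erefl).
  - exact: (subset_initialS erefl).
  - by apply: disjointWl dA'; rewrite subD1set.
  - by rewrite setD1K.
have [nA|nA] := boolP (n \in A); first exact: add.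
have [nB|nB] := boolP (n \in B).
  by apply: (sg_sym sgI); apply: add => //; exact: d_separated_sym.
have [nS|nS] := boolP (n \in S); last first.
  by apply: IHm => //; apply: (subset_initialS erefl).
rewrite -(setD1K nS) in sepAB *; set S' := S :\ n in sepAB *.
have S'm : S' \subset initial rk (rk n).+1 by rewrite (subset_trans _ Sm) // subD1set.
have dAS' : [disjoint A & S'] by apply: disjointWr dAS; rewrite subD1set.
have dBS' : [disjoint B & S'] by apply: disjointWr dBS; rewrite subD1set.
have sep' : d_separated G A B S'.
  move=> a b aA bB /walk_connectedP[s [path_s last_s open_s]].
  apply: (sepAB a b) => //; apply/walk_connectedP; exists s; split=> //.
  apply: (open_walk_add_top rk_arc) => //.
  apply: (open_walk_initial rk_arc S'm) => //.
    by have := subsetP Am _ aA; rewrite inE.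
  by rewrite last_s; have := subsetP Bm _ bB; rewrite inE.
have half A' B' : n \notin A' -> A' \subset initial rk (rk n).+1 ->
    B' \subset initial rk (rk n).+1 -> [disjoint A' & S'] -> [disjoint B' & S'] ->
    d_separated G A' B' S' -> d_separated G B' [set n] S' -> I A' B' (n |: S').
  move=> nA' A'm B'm dA' dB' sepA'B' sepB'n.
  apply: (sg_sym sgI); rewrite setUC; apply: (sg_weak_union sgI).
  apply: (sg_sym sgI); rewrite setUC; apply: add => //.
  - by rewrite subUset sub1set inE ltnSn.
  - rewrite disjoints_subset subUset sub1set !inE eqxx /=.
    by rewrite -disjoints_subset.
  - by rewrite setU11.
  - move=> x b; rewrite in_setU1 => /orP[/eqP->|xA] bB; last exact: sepA'B'.
    by apply: (d_separated_sym sepB'n) => //; rewrite set11.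
case: (separated_or nA nB Am Bm S'm sepAB) => [sepAn|sepBn]; last exact: half.
by apply: (sg_sym sgI); apply: half => //; exact: d_separated_sym.
Qed.

Theorem global_markov A B S : [disjoint A & S] -> [disjoint B & S] ->
  d_separated G A B S -> I A B S.
Proof.
have sub (C : {set 'I_p}) : C \subset initial rk (\max_x rk x).+1.
  by apply/subsetP => x _; rewrite inE ltnS leq_bigmax.
exact: global_below_all.
Qed.

End GlobalMarkov.

End Graphs.

Section ConditionalIndependence.
Import Order.TTheory GRing.Theory Num.Theory.
Local Open Scope ring_scope.
Local Open Scope classical_set_scope.
Local Open Scope ereal_scope.

(** * Image measures and conditional densities *)

Section ImageMeasure.
Context dX dY (X : measurableType dX) (Y : measurableType dY) (R : realType).
Variables (mu : {measure set X -> \bar R}) (f : {mfun X >-> Y}).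

(** A pushforward along a bundled measurable function, so that type inference finds
    its measure structure. *)
Definition image_measure := pushforward mu f.

Let image0 : image_measure set0 = 0. Proof. exact: measure0. Qed.
Let image_ge0 A : 0 <= image_measure A. Proof. exact: measure_ge0. Qed.
Let image_sigma_additive : semi_sigma_additive image_measure.
Proof.
move=> F mF tF mUF; rewrite /image_measure /pushforward preimage_bigcup.
apply: measure_semi_sigma_additive.
- by move=> n; exact: measurable_funPTI.
- apply/trivIsetP => /= i k _ _ ik; rewrite -preimage_setI.
  by move/trivIsetP : tF => /(_ _ _ _ _ ik) ->//; rewrite preimage_set0.
- by rewrite -preimage_bigcup; exact: measurable_funPTI.
Qed.
HB.instance Definition _ :=
  isMeasure.Build _ _ _ image_measure image0 image_ge0 image_sigma_additive.
End ImageMeasure.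

Lemma ge0_integral_mrestr dX (X : measurableType dX) (R : realType)
    (P : {measure set X -> \bar R}) (E D : set X) (mE : measurable E)
    (g : X -> \bar R) : measurable D -> measurable_fun D g ->
    (forall x, D x -> 0 <= g x) ->
  \int[mrestr P mE]_(x in D) g x = \int[P]_(x in D `&` E) g x.
Proof.
move=> mD mg g0.
have mDE : measurable (D `&` E) by exact: measurableI.
have mDCE : measurable (D `\` E) by exact: measurableD.
rewrite -[in LHS](setUIDK D E) ge0_integral_setU ?setUIDK//; last first.
  by rewrite disj_set2E; apply/eqP; rewrite -subset0 => x [[_ Ex] []].
rewrite [X in _ + X](eq_measure_integral mzero); last first.
  move=> A mA AD; have AE : A `&` E = set0 by rewrite -subset0 => x [/AD[]].
  by rewrite /= /mrestr /mzero AE measure0.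
rewrite integral_measure_zero adde0.
apply: eq_measure_integral => A mA AD.
by rewrite /= /mrestr setIidl// => x /AD[].
Qed.

Section Disintegration.
Context dX dY (X : measurableType dX) (Y : measurableType dY) (R : realType).
Variables (P : probability X R) (phi : {mfun X >-> Y}).
Variables (E : set X) (mE : measurable E).

Let nu := image_measure (mrestr P mE) phi.
HB.instance Definition _ := Measure.on nu.
Let nu_fin : fin_num_fun nu.
Proof.
move=> A mA; rewrite -[nu A]/(P (phi @^-1` A `&` E)) fin_num_measure//.
by apply: measurableI => //; exact: measurable_funPTI.
Qed.
HB.instance Definition _ := Measure_isFinite.Build _ _ _ nu nu_fin.

(** [f] is the Radon-Nikodym derivative, with respect to the law of [phi], of the
    law of [phi] restricted to [E]; so [f \o phi] is a version of [P(E | phi)].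
    The change of variables formula for this density is the pull-out property of
    conditional expectations. *)
Lemma cond_prob_density : exists f : Y -> R,
  [/\ forall y, (0 <= f y)%R, measurable_fun setT f
    & forall (g : Y -> \bar R) (C : set Y), (forall y, 0 <= g y) ->
        measurable_fun setT g -> measurable C ->
      \int[P]_(x in phi @^-1` C) (g (phi x) * (f (phi x))%:E) =
      \int[P]_(x in phi @^-1` C `&` E) g (phi x)].
Proof.
pose mu : {finite_measure set Y -> \bar R} := distribution P phi.
have numu : nu `<< mu.
  apply/null_content_dominatesP => A mA muA0.
  apply: (@subset_measure0 _ _ _ P _ (phi @^-1` A)) => //.
  - by apply: measurableI => //; exact: measurable_funPTI.
  - exact: measurable_funPTI.
pose f := Radon_Nikodym_SigmaFinite.f nu mu.
have f_fin y : f y \is a fin_num by exact: Radon_Nikodym_SigmaFinite.f_fin_num.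
have mf : measurable_fun setT f.
  exact: measurable_int (Radon_Nikodym_SigmaFinite.f_integrable numu).
exists (fine \o f); split => [y||g C g0 mg mC].
- by apply: fine_ge0; exact: Radon_Nikodym_SigmaFinite.f_ge0.
- exact: measurableT_comp.
transitivity (\int[mu]_(y in C) (g y * f y)).
  rewrite ge0_integral_pushforward//.
  - by apply: eq_integral => x _ /=; rewrite fineK.
  - by apply: measurable_funTS; exact: emeasurable_funM.
  - by move=> y _; rewrite mule_ge0// Radon_Nikodym_SigmaFinite.f_ge0.
rewrite Radon_Nikodym_SigmaFinite.change_of_variables//; last exact: measurable_funTS.
rewrite ge0_integral_pushforward//; last exact: measurable_funTS.
rewrite ge0_integral_mrestr//; first exact: measurable_funPTI.
- by apply: measurable_funTS; exact: measurableT_comp.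
- by move=> x _; exact: g0.
Qed.
End Disintegration.

(** * The sigma-algebras of the coordinates *)

Section Coordinates.
Context (R : realType) (p : nat) (d : 'I_p -> measure_display).
Context (T : forall i, measurableType (d i)).
Implicit Types (A B C S : {set 'I_p}) (D : set (forall i, T i)).

Lemma coord_measurableS S S' D : S \subset S' ->
  @measurable _ (coord_space T S) D -> @measurable _ (coord_space T S') D.
Proof.
move=> SS'; apply: sub_sigma_algebra2 => V [i iS ViV]; exists i => //.
exact: (fintype.subsetP SS').
Qed.

Lemma coord_measurable_funS dU (U : measurableType dU) S S'
    (h : (forall i, T i) -> U) : S \subset S' ->
  measurable_fun setT (h : coord_space T S -> U) ->
  measurable_fun setT (h : coord_space T S' -> U).
Proof. by move=> SS' mh _ V mV; apply: (coord_measurableS SS'); exact: mh. Qed.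

Lemma joint_measurable S D :
  @measurable _ (coord_space T S) D -> @measurable _ (joint_space T) D.
Proof. by apply: coord_measurableS; exact: finset.subsetT. Qed.

Lemma joint_measurable_fun dU (U : measurableType dU) S
    (h : (forall i, T i) -> U) :
  measurable_fun setT (h : coord_space T S -> U) ->
  measurable_fun setT (h : joint_space T -> U).
Proof. by apply: coord_measurable_funS; exact: finset.subsetT. Qed.

Lemma coord_measurable S i (V : set (T i)) : i \in S -> measurable V ->
  @measurable _ (coord_space T S) [set x | V (x i)].
Proof.
move=> iS mV; apply: sub_sigma_algebra; exists i => //.
by exists V => //; rewrite setTI.
Qed.

Lemma measurable_to_coord dZ (Z : measurableType dZ) S (f : Z -> coord_space T S) :
  (forall i, i \in S -> measurable_fun setT (fun z => f z i)) ->
  measurable_fun setT f.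
Proof.
move=> mf.
apply: (@measurability _ _ _ (coord_space T S) setT f (coord_sets T S) erefl).
move=> _ [_ [i iS [V mV <-]] <-].
rewrite setTI; exact: mf.
Qed.

Lemma measurable_coord S i : i \in S ->
  measurable_fun setT (fun x : coord_space T S => x i).
Proof. by move=> iS _ V mV; rewrite setTI; exact: coord_measurable. Qed.

(** The sets invariant under changes of the coordinate [j] form a sigma-algebra
    containing the generators of the sigma-algebra of [S]. *)
Lemma coord_measurable_dfwith S j (b : T j) D (x : forall i, T i) : j \notin S ->
  @measurable _ (coord_space T S) D -> D (dfwith x j b) <-> D x.
Proof.
move=> jS mD; move: D mD x.
pose H := [set D | forall x : forall i, T i, D (dfwith x j b) <-> D x].
suff : <<s coord_sets T S >> `<=` H by move=> sub D mD x; exact: (sub D mD).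
apply: smallest_sub; last first.
  move=> _ [i iS [V mV <-]] x; rewrite setTI /preimage /= dfwithout//.
  by apply: contraNneq jS => ->.
split => [x //|D HD x|F HF x]; rewrite ?setTD /=.
- by split; apply: contra_not => /HD.
- by split=> -[n _ Fn]; exists n => //; apply/HF.
Qed.

Lemma coord_measurable_fun_dfwith S j (b : T j)
    (h : (forall i, T i) -> R) (x : forall i, T i) : j \notin S ->
  measurable_fun setT (h : coord_space T S -> R) -> h (dfwith x j b) = h x.
Proof.
move=> jS mh.
have mD : @measurable _ (coord_space T S) (h @^-1` [set h x]).
  by rewrite -[X in measurable X]setTI; apply: mh => //; exact: measurable_set1.
by have /(_ erefl) := (coord_measurable_dfwith b x jS mD).2.
Qed.

Lemma measurable_dfwith_coord S j (b : T j) :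
  measurable_fun setT
    ((fun x : forall i, T i => dfwith x j b : forall i, T i)
      : coord_space T S -> coord_space T (S :|: [set j])%SET).
Proof.
apply: measurable_to_coord => i; have [->{i}|ij] := eqVneq i j.
  move=> _; apply: (@eq_measurable_fun _ _ (coord_space T S) (T j) setT (cst b));
    last exact: measurable_cst.
  by move=> x _; rewrite /= dfwithin.
rewrite !inE (negPf ij) orbF => iS.
apply: (@eq_measurable_fun _ _ (coord_space T S) (T i) setT (fun x => x i)).
  by move=> x _; rewrite /= dfwithout // eq_sym.
exact: measurable_coord.
Qed.

Lemma measurable_dfwith_joint j :
  measurable_fun setT
    ((fun bx : T j * (forall i, T i) => dfwith bx.2 j bx.1 : forall i, T i)
      : T j * joint_space T -> joint_space T).
Proof.
apply: measurable_to_coord => i _; have [->{i}|ij] := eqVneq i j.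
  apply: (@eq_measurable_fun _ _ (T j * joint_space T)%type (T j) setT fst); last exact: measurable_fst.
  by move=> x _; rewrite /= dfwithin.
apply: (@eq_measurable_fun _ _ (T j * joint_space T)%type (T i) setT
  (fun bx => (bx.2 : forall i, T i) i)).
  by move=> x _; rewrite /= dfwithout // eq_sym.
apply: (measurableT_comp (f := fun x : joint_space T => x i)) => //.
by apply: measurable_coord; rewrite inE.
Qed.

End Coordinates.

(** * Versions of conditional probabilities *)

Section Versions.
Context (R : realType) (p : nat) (d : 'I_p -> measure_display).
Context (T : forall i, measurableType (d i)) (P : probability (joint_space T) R).
Implicit Types (A B S : {set 'I_p}) (C D E F : set (joint_space T)).
Implicit Types (g h : joint_space T -> R).

Lemma measurable_id_coord S :
  measurable_fun setT (id : joint_space T -> coord_space T S).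
Proof. by move=> _ D mD; rewrite setTI; exact: joint_measurable mD. Qed.

(** The last clause is the pull-out property; it is only stated for nonnegative
    functions, which spares all integrability conditions. *)
Lemma cond_prob_exists S E : measurable E -> exists h,
  [/\ forall x, (0 <= h x)%R, is_cond_prob P S E h
    & forall g C, (forall x, (0 <= g x)%R) ->
        measurable_fun setT (g : coord_space T S -> R) ->
        @measurable _ (coord_space T S) C ->
      \int[P]_(x in C) (g x * h x)%:E = \int[P]_(x in C `&` E) (g x)%:E].
Proof.
move=> mE.
pose phi : {mfun joint_space T >-> coord_space T S} :=
  HB.pack (id : joint_space T -> coord_space T S)
    (isMeasurableFun.Build _ _ _ _ _ (@measurable_id_coord S)).
have [h [h0 mh pull]] := cond_prob_density P phi mE.
have {}pull g C : (forall x, (0 <= g x)%R) ->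
    measurable_fun setT (g : coord_space T S -> R) ->
    @measurable _ (coord_space T S) C ->
    \int[P]_(x in C) (g x * h x)%:E = \int[P]_(x in C `&` E) (g x)%:E.
  move=> g0 mg mC.
  apply: (pull (EFin \o g) C) => //.
  exact/measurable_EFinP.
have intC C : @measurable _ (coord_space T S) C ->
    \int[P]_(x in C) (h x)%:E = P (C `&` E).
  move=> mC; have := pull (cst 1%R) C (fun=> ler01) (measurable_cst _) mC.
  under eq_integral do rewrite mul1r.
  move=> ->; rewrite -[RHS]mul1e -integral_cst//.
  by apply: measurableI => //; exact: joint_measurable mC.
exists h; split => //; split => //.
apply/integrableP; split.
  by apply/measurable_EFinP; exact: joint_measurable_fun mh.
under eq_integral do rewrite /= ger0_norm//.
by rewrite intC// setTI (le_lt_trans (probability_le1 _ mE))// ltry.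
Qed.

Lemma cond_prob_ae_unique S E h h' : is_cond_prob P S E h ->
  is_cond_prob P S E h' -> {ae P, forall x, h x = h' x}.
Proof.
move=> [mh ih Eh] [mh' ih' Eh'].
pose phi : {mfun joint_space T >-> coord_space T S} :=
  HB.pack (id : joint_space T -> coord_space T S)
    (isMeasurableFun.Build _ _ _ _ _ (@measurable_id_coord S)).
have [N [mN N0 sub]] :
    ae_eq (distribution P phi) setT (EFin \o h : coord_space T S -> \bar R) (EFin \o h').
  apply: integral_ae_eq => //.
  - by apply: integrable_pushforward => //; exact/measurable_EFinP.
  - exact/measurable_EFinP.
  - move=> C _ mC; rewrite !integral_pushforward//; last 4 first.
    + exact/measurable_EFinP.
    + by apply: integrableS ih' => //; exact: joint_measurable mC.
    + exact/measurable_EFinP.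
    + by apply: integrableS ih => //; exact: joint_measurable mC.
    by rewrite [LHS]Eh// [RHS]Eh'.
exists N; split => //; first exact: joint_measurable mN.
by move=> x /= hx; apply: sub => /= /(_ I) [].
Qed.

Lemma cond_prob_ae S E h h' : is_cond_prob P S E h ->
  measurable_fun setT (h' : coord_space T S -> R) ->
  {ae P, forall x, h x = h' x} -> is_cond_prob P S E h'.
Proof.
move=> [mh ih Eh] mh' hh'.
have mEh : measurable_fun setT (EFin \o h) by apply/measurable_EFinP; exact: joint_measurable_fun mh.
have mEh' : measurable_fun setT (EFin \o h') by apply/measurable_EFinP; exact: joint_measurable_fun mh'.
have aeD D : ae_eq P D (EFin \o h) (EFin \o h').
  by apply: filterS hh' => x /= ->.
split=> // [|C mC].
  apply/integrableP; split => //; move/integrableP: ih => [_].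
  rewrite (ae_eq_integral (abse \o (EFin \o h'))) //.
  - exact: measurableT_comp.
  - exact: measurableT_comp.
  - exact: ae_eq_abse.
rewrite -Eh//; apply/esym/ae_eq_integral => //.
- exact: joint_measurable mC.
- exact: measurable_funTS.
- exact: measurable_funTS.
Qed.

Lemma cond_prob_sub S S' E h : S \subset S' -> is_cond_prob P S' E h ->
  measurable_fun setT (h : coord_space T S -> R) -> is_cond_prob P S E h.
Proof.
move=> SS' [mh ih Eh] mh'; split => // C mC.
by apply: Eh; exact: (coord_measurableS SS').
Qed.

(** A generating system stable under intersections, for use with Dynkin's lemma. *)
Lemma coord_set_gen S B :
  @measurable _ (coord_space T (S :|: B)%SET) =
  <<s [set X | exists C F, [/\ @measurable _ (coord_space T S) C,
                               @measurable _ (coord_space T B) F & X = C `&` F]] >>.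
Proof.
apply/seteqP; split.
  apply: sub_sigma_algebra2 => V [i].
  rewrite /= inE => /orP[iS|iB] ViV.
  - exists V, setT; rewrite setIT; split=> //.
    by apply: sub_sigma_algebra; exists i.
  - exists setT, V; rewrite setTI; split=> //.
    by apply: sub_sigma_algebra; exists i.
apply: smallest_sub; first exact: sigma_algebra_measurable.
move=> _ [C [F [mC mF ->]]].
apply: (@measurableI _ (coord_space T (S :|: B)%SET)).
- by apply: coord_measurableS mC; rewrite finset.subsetUl.
- by apply: coord_measurableS mF; rewrite finset.subsetUr.
Qed.

(** The asymmetric form of conditional independence: [P(E | S, B) = P(E | S)].  From
    left to right, [P(E | S)] has the right integral over intersections of events
    of [S] and of [B] by the pull-out property, hence over all events of [S, B] by
    Dynkin's lemma.  From right to left, the product formula is again the pull-out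
    property. *)
Lemma cond_indepP A B S : cond_indep P A B S <->
  forall E, @measurable _ (coord_space T A) E ->
    exists h, is_cond_prob P S E h /\ is_cond_prob P (S :|: B)%SET E h.
Proof.
split=> [ci E mE|ci E F mE mF]; last first.
  have mEj : @measurable _ (joint_space T) E by exact: joint_measurable mE.
  have mFj : @measurable _ (joint_space T) F by exact: joint_measurable mF.
  have [e [cpe cpeB]] := ci E mE.
  have [e0 [e0_ge0 cpe0 _]] := cond_prob_exists S mEj.
  have [f0 [f0_ge0 cpf0 pull]] := cond_prob_exists S mFj.
  have [me0 _ _] := cpe0; have [mf0 _ _] := cpf0.
  have cpe0B : is_cond_prob P (S :|: B)%SET E e0.
    apply: (cond_prob_ae cpeB); last exact: cond_prob_ae_unique cpe cpe0.
    by apply: coord_measurable_funS me0; rewrite finset.subsetUl.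
  have prodE C : @measurable _ (coord_space T S) C ->
      \int[P]_(x in C) ((e0 \* f0)%R x)%:E = P (C `&` (E `&` F)).
    move=> mC; rewrite pull// (setIC E) setIA; have [_ _] := cpe0B; apply.
    apply: (@measurableI _ (coord_space T (S :|: B)%SET)).
    - by apply: coord_measurableS mC; rewrite finset.subsetUl.
    - by apply: coord_measurableS mF; rewrite finset.subsetUr.
  exists e0, f0; split => //; split => //.
    exact: measurable_funM.
  apply/integrableP; split.
    by apply/measurable_EFinP; apply: measurable_funM;
      [exact: joint_measurable_fun me0|exact: joint_measurable_fun mf0].
  under eq_integral do rewrite /= ger0_norm ?mulr_ge0//.
  rewrite prodE// setTI (le_lt_trans (probability_le1 _ _)) ?ltry//.
  exact: measurableI.
have mEj : @measurable _ (joint_space T) E by exact: joint_measurable mE.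
have [e0 [e0_ge0 cpe0 _]] := cond_prob_exists S mEj.
exists e0; split=> //; have [me0 ie0 Ee0] := cpe0.
have me0' : measurable_fun setT (EFin \o e0).
  apply/measurable_EFinP; exact: joint_measurable_fun me0.
split=> //; first by apply: coord_measurable_funS me0; rewrite finset.subsetUl.
pose Q := [set D : set (coord_space T (S :|: B)%SET) |
  \int[P]_(x in (D : set (joint_space T))) (e0 x)%:E = P (D `&` E)].
move=> D; rewrite coord_set_gen => mD.
apply: (@dynkin_induction _ (coord_space T (S :|: B)%SET) _ Q (coord_set_gen S B)) mD.
- move=> _ _ [C [F [mC mF ->]]] [C' [F' [mC' mF' ->]]].
  exists (C `&` C'), (F `&` F'); split.
  + exact: (@measurableI _ (coord_space T S)).
  + exact: (@measurableI _ (coord_space T B)).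
  + by rewrite setIACA.
- exact: (Ee0 setT measurableT).
- move=> _ [C [F [mC mF ->]]].
  have mFj : @measurable _ (joint_space T) F by exact: joint_measurable mF.
  have mCj : @measurable _ (joint_space T) C by exact: joint_measurable mC.
  have [f0 [f0_ge0 cpf0 pull]] := cond_prob_exists S mFj.
  have [e [f [cpe cpf [mef ief Eef]]]] := ci E F mE mF.
  have [mf0 _ _] := cpf0.
  rewrite /Q /= -pull// -setIA (setIC F) -Eef//.
  apply: ae_eq_integral => //.
  + apply: measurable_funTS; apply/measurable_EFinP.
    by apply: measurable_funM;
      [exact: joint_measurable_fun me0|exact: joint_measurable_fun mf0].
  + exact: measurable_funTS (measurable_int _ ief).
  + have := cond_prob_ae_unique cpe0 cpe; have := cond_prob_ae_unique cpf0 cpf.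
    by apply: filterS2 => x /= -> ->.
- move=> D' /joint_measurable mD' QD'; rewrite /Q /=.
  have fin : \int[P]_(x in D') (e0 x)%:E \is a fin_num.
    by rewrite QD' fin_num_measure//; exact: measurableI.
  have := Ee0 setT measurableT.
  rewrite -(setvU D') ge0_integral_setU//; last 4 first.
  + exact: measurableC.
  + by rewrite setvU.
  + by move=> x _; rewrite lee_fin.
  + by rewrite disj_set2E setICl.
  rewrite setIUl measureU//; last 3 first.
  + by apply: measurableI => //; exact: measurableC.
  + exact: measurableI.
  + by rewrite setIACA setICl set0I.
  rewrite QD' => /(congr1 (fun u => u - P (D' `&` E))).
  by rewrite !addeK// fin_num_measure//; exact: measurableI.
- move=> F' mF' tF' QF'; rewrite /Q /=.
  have mFj k : @measurable _ (joint_space T) (F' k) by exact: joint_measurable (mF' k).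
  rewrite ge0_integral_bigcup//; last 2 first.
  + exact: measurable_funTS.
  + by move=> x _; rewrite lee_fin.
  rewrite (@eq_eseriesl _ _ (fun k => k \in [set: nat])); last first.
    by move=> k; rewrite in_setT.
  rewrite setI_bigcupl measure_bigcup//; last 2 first.
  + by move=> k _; exact: measurableI.
  + by apply: trivIset_setIr.
  by apply: eq_eseriesr => k _; exact: QF'.
Qed.

End Versions.

(** * The semi-graphoid axioms for conditional independence *)

Section SemiGraphoid.
Context (R : realType) (p : nat) (d : 'I_p -> measure_display).
Context (T : forall i, measurableType (d i)) (P : probability (joint_space T) R).

(** In the form [cond_indepP], weak union and contraction compare a single version
    over nested conditioning sets; contraction also uses almost sure uniqueness. *)
Lemma cond_indep_semi_graphoid : semi_graphoid (cond_indep P).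
Proof.
split=> [A S|A B S ci E F mE mF|A B B' S B'B ci E F mE mF|A B C S|A B C S].
- apply/cond_indepP => E mE.
  have mEj : @measurable _ (joint_space T) E by exact: joint_measurable mE.
  have [h [_ cph _]] := cond_prob_exists P S mEj.
  by exists h; rewrite finset.setU0.
- have [f [e [cpf cpe cpfe]]] := ci F E mF mE.
  exists e, f; split=> //; rewrite setIC.
  suff -> : (e \* f = f \* e)%R by [].
  by apply/funext => x /=; rewrite mulrC.
- by apply: ci => //; exact: coord_measurableS B'B mF.
- move=> /cond_indepP ci; apply/cond_indepP => E mE.
  have [h [cph cphBC]] := ci E mE; exists h; split.
  + apply: (cond_prob_sub _ cphBC).
      by apply: finset.setUS; exact: finset.subsetUr.
    by have [mh _ _] := cph; apply: coord_measurable_funS mh; exact: finset.subsetUl.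
  + by rewrite -finset.setUA (finset.setUC C).
- move=> /cond_indepP ciB /cond_indepP ciC; apply/cond_indepP => E mE.
  have [h [cph cphB]] := ciB E mE; have [h' [cph'B cph'BC]] := ciC E mE.
  exists h; split=> //; rewrite finset.setUA; apply: (cond_prob_ae cph'BC).
    have [mh _ _] := cph; apply: coord_measurable_funS mh.
    by rewrite -finset.setUA; exact: finset.subsetUl.
  exact: cond_prob_ae_unique cph'B cphB.
Qed.

End SemiGraphoid.

(** * Redrawing one coordinate under a product measure *)

Section FiniteProduct.
Context (R : realType) (p : nat) (d : 'I_p -> measure_display).
Context (T : forall i, measurableType (d i)).
Variable nu : forall i, {finite_measure set (T i) -> \bar R}.
Variable m : {finite_measure set (joint_space T) -> \bar R}.
Hypothesis prod_m : is_product_measure nu m.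
Variable j : 'I_p.

Let phi : T j * joint_space T -> joint_space T :=
  fun bx => dfwith (bx.2 : forall i, T i) j bx.1.

Let mphi : {mfun (T j * joint_space T)%type >-> joint_space T} :=
  HB.pack phi (isMeasurableFun.Build _ _ _ _ phi (@measurable_dfwith_joint p d T j)).
Let m_phi := image_measure (nu j \x m) mphi.

Definition rectangles : set (set (joint_space T)) :=
  [set X | exists2 A : forall i, set (T i), (forall i, measurable (A i)) &
     X = [set x | forall i, A i (x i)]].

Lemma measurable_rectangle (A : forall i, set (T i)) : (forall i, measurable (A i)) ->
  @measurable _ (joint_space T) [set x : forall i, T i | forall i, A i (x i)].
Proof.
move=> mA.
have -> : [set x : forall i, T i | forall i, A i (x i)] =
    \bigcap_(i in [set: 'I_p]) [set x | A i (x i)].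
  by apply/seteqP; split=> x /= Ax i; [move=> _|]; exact: Ax.
apply: (@fin_bigcap_measurable _ (joint_space T)) => // i _.
by apply: coord_measurable => //; rewrite inE.
Qed.

Lemma joint_rectangles : @measurable _ (joint_space T) = <<s rectangles >>.
Proof.
apply/seteqP; split.
  apply: sub_sigma_algebra2 => _ [i _ [V mV <-]].
  exists (dfwith (fun k : 'I_p => [set: T k]) i V).
    move=> k; have [<-|ik] := eqVneq i k; first by rewrite dfwithin.
    by rewrite dfwithout.
  rewrite setTI; apply/seteqP; split=> x /=.
    move=> Vx k; have [<-|ik] := eqVneq i k; first by rewrite dfwithin.
    by rewrite dfwithout.
  by move/(_ i); rewrite dfwithin.
apply: smallest_sub; first exact: sigma_algebra_measurable.
by move=> _ [A mA ->]; exact: measurable_rectangle.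
Qed.

(** Redrawing the coordinate [j] independently from [nu j] preserves a product
    measure up to total mass: both sides are finite measures in [N], and they agree
    on rectangles. *)
Lemma product_measure_resample N : @measurable _ (joint_space T) N ->
  (nu j \x m) (phi @^-1` N) = nu j setT * m N.
Proof.
pose r : {nonneg R} := NngNum (fine_ge0 (measure_ge0 (nu j) setT)).
have rE : r%:num%:E = nu j setT.
  by rewrite /= fineK// fin_num_measure.
rewrite -rE -[LHS]/(m_phi N) -[RHS]/(mscale r m N).
rewrite joint_rectangles => sN.
apply: (@g_sigma_algebra_measure_unique _ _ _ rectangles _ (fun=> setT) _ _ m_phi (mscale r m)) sN.
- by rewrite joint_rectangles; exact: sub_sigma_algebra.
- by move=> _; exists (fun=> setT) => //; apply/seteqP; split.
- by rewrite bigcup_const.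
- move=> _ _ [A mA ->] [B mB ->]; exists (fun i => A i `&` B i).
    by move=> i; exact: measurableI.
  apply/seteqP; split=> [x [Ax Bx] i|x ABx]; first by split.
  by split=> i; case: (ABx i).
- move=> _ [A mA ->].
  rewrite -[LHS]/((nu j \x m) (phi @^-1` [set x | forall i, A i (x i)])).
  pose A' := dfwith A j setT.
  have mA' i : measurable (A' i).
    rewrite /A'; have [<-|ji] := eqVneq j i; first by rewrite dfwithin.
    by rewrite dfwithout.
  have -> : phi @^-1` [set x | forall i, A i (x i)] =
      A j `*` [set x : joint_space T | forall i, A' i (x i)].
    apply/seteqP; split=> [[b x]|[b x]]; rewrite /phi /= /A'.
      move=> Aphi; split=> [|i]; first by have := Aphi j; rewrite dfwithin.
      have [<-|ji] := eqVneq j i; first by rewrite dfwithin.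
      by have := Aphi i; rewrite !dfwithout.
    move=> [Ab Ax] i; have [<-|ji] := eqVneq j i; first by rewrite dfwithin.
    by have := Ax i; rewrite !dfwithout.
  rewrite product_measure1E//; last exact: measurable_rectangle.
  rewrite [X in _ * X](_ : _ = \prod_(i < p) nu i (A' i)); last exact: prod_m.
  rewrite -[RHS]/(_ * m [set x | forall i, A i (x i)]) rE.
  rewrite [X in _ = _ * X](_ : _ = \prod_(i < p) nu i (A i)); last exact: prod_m.
  rewrite (bigD1 j)//= [in RHS](bigD1 j)//=.
  rewrite {1}/A' dfwithin muleCA; congr (_ * (_ * _)).
  by apply: eq_bigr => i ij; rewrite /A' dfwithout// eq_sym.
- move=> _; rewrite -[X in X < _]/((nu j \x m) setT) -setXTT product_measure1E//.
  by apply: lte_mul_pinfty; rewrite ?fin_num_measure// ltey_eq fin_num_measure.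
Qed.

(** Tonelli's theorem applied to [product_measure_resample]. *)
Lemma product_null_resample N : @measurable _ (joint_space T) N -> m N = 0 ->
  {ae nu j, forall b, m [set x | N (dfwith (x : forall i, T i) j b)] = 0}.
Proof.
move=> mN mN0; have := product_measure_resample mN; rewrite mN0 mule0 /product_measure1.
have mphiN : measurable (phi @^-1` N).
  by rewrite -[X in measurable X]setTI; apply: measurable_dfwith_joint.
have mF := measurable_fun_xsection m mphiN.
rewrite -[X in X = _](_ : \int[nu j]_b `|m (xsection (phi @^-1` N) b)| = _); last first.
  by apply: eq_integral => b _; rewrite gee0_abs.
move/(ae_eq_integral_abs _ measurableT mF); apply: filterS => b /= /(_ I).
by rewrite /xsection /=; under eq_set do rewrite inE.
Qed.

End FiniteProduct.

Section SigmaFiniteProduct.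
Context (R : realType) (p : nat) (d : 'I_p -> measure_display).
Context (T : forall i, measurableType (d i)).
Variable mu : forall i, {sigma_finite_measure set (T i) -> \bar R}.
Variable m : {measure set (joint_space T) -> \bar R}.
Hypothesis prod_m : is_product_measure mu m.
Implicit Types (N : set (joint_space T)) (j : 'I_p).

Lemma measurable_resample j (b : T j) N : measurable N ->
  measurable ([set x | N (dfwith (x : forall i, T i) j b)] : set (joint_space T)).
Proof.
move=> mN; have := @measurable_dfwith_coord p d T [set: 'I_p]%SET j b measurableT N.
rewrite setTI; apply.
by apply: coord_measurableS mN; exact: finset.subsetUl.
Qed.

(** The marginals are exhausted by sets of finite measure; on the corresponding
    boxes the measures are finite and [product_null_resample] applies. *)
Lemma null_resample j N : measurable N -> m N = 0 ->
  {ae mu j, forall b, m [set x | N (dfwith (x : forall i, T i) j b)] = 0}.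
Proof.
move=> mN N0.
have exhaust i : exists F : (set (T i))^nat, [/\ setT = \bigcup_n F n, nondecreasing_seq F
    & forall n, measurable (F n) /\ mu i (F n) < +oo].
  exact/sigma_finiteP/sigma_finiteT.
pose K i := sval (cid (exhaust i)).
have KP i : [/\ setT = \bigcup_n K i n, nondecreasing_seq (K i)
    & forall n, measurable (K i n) /\ mu i (K i n) < +oo] := svalP (cid (exhaust i)).
have cover i : [set: T i] = \bigcup_n K i n by have [] := KP i.
have ndK i : nondecreasing_seq (K i) by have [] := KP i.
have mK i n : measurable (K i n) by have [_ _ /(_ n)[]] := KP i.
have finK i n : mu i (K i n) < +oo by have [_ _ /(_ n)[]] := KP i.
pose box n : set (joint_space T) := [set x | forall i, K i n (x i)].
have mbox n : measurable (box n) by exact: (measurable_rectangle (fun i => mK i n)).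
have finbox n : m (box n) < +oo.
  rewrite -ge0_fin_numE// [m _](prod_m (fun i => mK i n)) prode_fin_num// => i _.
  by rewrite ge0_fin_numE.
have ae_n n : {ae mu j, forall b, K j n b ->
    m ([set x | N (dfwith (x : forall i, T i) j b)] `&` box n) = 0}.
  pose nu i : {finite_measure set (T i) -> \bar R} := mfrestr (mK i n) (finK i n).
  pose mn : {finite_measure set (joint_space T) -> \bar R} := mfrestr (mbox n) (finbox n).
  have prod_mn : is_product_measure nu mn.
    move=> A mA; rewrite /mn /= /mfrestr /mrestr.
    have -> : [set x : joint_space T | forall i, A i (x i)] `&` box n =
        [set x | forall i, (A i `&` K i n) (x i)].
      by apply/seteqP; split=> [x [Ax Kx] i|x AKx]; split=> // i; case: (AKx i).
    by apply: prod_m => i; exact: measurableI.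
  have mnN0 : mn N = 0.
    by apply: subset_measure0 N0 => //; first exact: measurableI.
  have [Z [mZ Z0 subZ]] := product_null_resample prod_mn j mN mnN0.
  exists (Z `&` K j n); split => //; first exact: measurableI.
  by move=> b /= /not_implyP[Kb nb]; split=> //; apply: subZ => /=.
move/ae_foralln: ae_n; apply: filterS => b ae_b.
have [n0 _ Kb] : (\bigcup_n K j n) b by rewrite -cover.
have mNb := measurable_resample b mN.
apply/negligibleP => //.
suff -> : [set x | N (dfwith (x : forall i, T i) j b)] =
    \bigcup_n ([set x | N (dfwith (x : forall i, T i) j b)] `&` box (n0 + n)%N).
  apply: negligible_bigcup => n; apply/negligibleP; first exact: measurableI.
  apply: ae_b.
  by move: Kb; apply/subsetPset; apply: ndK; rewrite leq_addr.
apply/seteqP; split=> [x Nx|x [n _ []//]].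
have /choice[k Kk] : forall i, exists n, K i n (x i).
  move=> i; have [n _ Kx] : (\bigcup_n K i n) (x i) by rewrite -cover.
  by exists n.
exists (\max_i k i)%N => //; split=> // i.
move: (Kk i); apply/subsetPset; apply: ndK.
by rewrite (leq_trans (leq_bigmax i))// leq_addl.
Qed.

End SigmaFiniteProduct.

(** * The intersection axiom for positive measures *)

Section Intersection.
Context (R : realType) (p : nat) (d : 'I_p -> measure_display).
Context (T : forall i, measurableType (d i)) (P : probability (joint_space T) R).
Hypothesis posP : positive_measure P.
Implicit Types (A B C S : {set 'I_p}) (N : set (joint_space T)) (j : 'I_p).

(** A positive density makes [P] and the product measure [m] have the same null
    sets.  As [m] is not zero, neither is its marginal [mu j], so that a property
    of [mu j]-almost all [b] holds for some [b]. *)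
Lemma positive_null_resample j N : measurable N -> P N = 0 ->
  exists b, P [set x | N (dfwith (x : forall i, T i) j b)] = 0.
Proof.
move=> mN PN0; have [mu [m [f [prod_m mf f0 Pf]]]] := posP.
have Pnull D : measurable D -> P D = 0 <-> m D = 0.
  move=> mD; have mfD : measurable_fun D (EFin \o f).
    by apply: measurable_funTS; exact/measurable_EFinP.
  split=> D0; last by rewrite Pf//; exact: null_set_integral.
  move: D0; rewrite Pf//.
  under eq_integral do rewrite -[(f _)%:E]gee0_abs ?lee_fin ?ltW//.
  move/(ae_eq_integral_abs _ mD mfD).
  move=> [Z [mZ Z0 subZ]]; apply: (subset_measure0 _ _ _ Z0) => // x Dx.
  apply: subZ => /= /(_ Dx) [fx0].
  by have := f0 x; rewrite fx0 ltxx.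
apply: contrapT => /forallNP nob.
have bad : ~` [set b | m [set x | N (dfwith (x : forall i, T i) j b)] = 0] = setT.
  apply/seteqP; split=> // b _ /= mb; apply: (nob b).
  by apply/Pnull => //; exact: measurable_resample.
have := null_resample prod_m j mN ((Pnull _ mN).1 PN0).
rewrite /almost_everywhere /prop_near1 /nbhs /= => ae.
have muj0 : mu j setT = 0.
  by apply/negligibleP => //; rewrite -bad.
have : P setT = 0.
  apply/Pnull => //.
  rewrite [X in m X](_ : _ = [set x : forall i, T i | forall i, [set: T i] (x i)]).
    by rewrite [m _](prod_m _ (fun i => @measurableT _ (T i))) (bigD1 j)//= muj0 mul0e.
  by apply/seteqP; split.
by rewrite probability_setT => /eqP; rewrite onee_eq0.
Qed.

(** Let [e1] and [e2] be the versions of [P(E | S, C, j)] that depend only on [S, C]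
    and only on [S, j].  They agree almost everywhere, and still do, for some [b],
    once the coordinate [j] is set to [b] in both.  This leaves [e1] unchanged and
    turns [e2] into a function of the coordinates [S]. *)
Lemma cond_indep_intersection A C S j : j \notin S -> j \notin C ->
  cond_indep P A [set j]%SET (S :|: C) -> cond_indep P A C (S :|: [set j])%SET ->
  cond_indep P A (C :|: [set j])%SET S.
Proof.
move=> jS jC /cond_indepP ci1 /cond_indepP ci2; apply/cond_indepP => E mE.
have [e1 [cp1 cp1j]] := ci1 E mE; have [e2 [cp2 cp2C]] := ci2 E mE.
have [me1 _ _] := cp1; have [me2 _ _] := cp2.
have /= [N [mN PN0 subN]] : {ae P, forall x, e1 x = e2 x}.
  apply: (cond_prob_ae_unique cp1j).
  by rewrite -finset.setUA (finset.setUC C) finset.setUA.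
have [b Pb0] := positive_null_resample j mN PN0.
pose e (x : joint_space T) := e2 (dfwith (x : forall i, T i) j b).
have me : measurable_fun setT (e : coord_space T S -> R).
  apply: (measurableT_comp (f := (e2 : coord_space T (S :|: [set j])%SET -> R))) => //.
  exact: measurable_dfwith_coord.
have ee : {ae P, forall x, e1 x = e x}.
  exists [set x | N (dfwith (x : forall i, T i) j b)]; split => //.
    exact: measurable_resample.
  move=> x /= ne; apply: subN => /=; apply: contra_not ne => e12.
  rewrite /e -e12 (@coord_measurable_fun_dfwith _ _ _ _ (S :|: C)%SET)//.
  by rewrite finset.in_setU negb_or jS.
have cpe : is_cond_prob P (S :|: (C :|: [set j]))%SET E e.
  rewrite finset.setUA; apply: (cond_prob_ae cp1j) => //.
  by apply: coord_measurable_funS me; rewrite -finset.setUA finset.subsetUl.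
exists e; split=> //.
by apply: cond_prob_sub cpe me; exact: finset.subsetUl.
Qed.

End Intersection.

End ConditionalIndependence.

(** * Permutation DAGs *)

Section PermutationDags.
Import fintype boot.finset.
Context (R : realType) (p : nat) (d : 'I_p -> measure_display).
Context (T : forall i, measurableType (d i)) (P : probability (joint_space T) R).
Implicit Types (pi : {perm 'I_p}) (G : dag p) (x y : 'I_p).

Definition position pi x : nat := (pi^-1)%g x.

Lemma position_inj pi : injective (position pi).
Proof. by move=> x y /val_inj/perm_inj. Qed.

Lemma predecessorsE pi k : predecessors pi k = initial (position pi) k.
Proof.
apply/setP => x; rewrite inE; apply/imsetP/idP => [[i]|xk].
  by rewrite inE /position => ik ->; rewrite permK.
by exists ((pi^-1)%g x); rewrite ?inE ?permKV.
Qed.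

Lemma perm_dag_arcP pi x y : arc_in (perm_dag P pi) x y <->
  position pi x < position pi y /\
  ~ cond_indep P [set x] [set y] (initial (position pi) (position pi y) :\ x).
Proof.
split=> [/imsetP[[j k]]|[xy dep]].
  rewrite inE /= => /andP[jk /asboolP dep] [-> ->].
  by rewrite -predecessorsE /position !permK; split.
apply/imsetP; exists ((pi^-1)%g x, (pi^-1)%g y); last by rewrite /= !permKV.
rewrite inE /=; apply/andP; split=> //; apply/asboolP.
by rewrite !permKV predecessorsE.
Qed.

Lemma perm_dag_sub_markov G pi : markov_to G P ->
  (forall x y, arc_in G x y -> position pi x < position pi y) ->
  edges (perm_dag P pi) \subset edges G.
Proof.
move=> markovG piG; apply/subsetP => -[x y] /perm_dag_arcP[xy dep].
apply: contra_notT dep => nxy; apply: markovG.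
  split; rewrite disjoints1 !inE ?ltnn ?andbF ?eqxx //.
  by apply: contraL xy => /eqP ->; rewrite ltnn.
exact: (nonadjacent_separated (@position_inj pi) piG xy nxy).
Qed.

Hypothesis posP : positive_measure P.

(** Members [j] of [N] are added one by one by the intersection axiom: the absence
    of an arc from [j] to [y] is the statement [y _||_ j | before \ j], and the
    induction hypothesis is [y _||_ N \ j | before \ (N \ j)]. *)
Lemma perm_dag_nonparents pi y (N : {set 'I_p}) :
  N \subset initial (position pi) (position pi y) :\: parents (perm_dag P pi) y ->
  cond_indep P [set y] N (initial (position pi) (position pi y) :\: N).
Proof.
set before := initial _ _.
have [n] := ubnP #|N|; elim: n N => // n IHn N; rewrite ltnS => Nn subN.
have [->|[j jN]] := set_0Vmem N.
  exact: sg_empty (cond_indep_semi_graphoid P) _ _.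
have := subsetP subN j jN; rewrite inE => /andP[nonpar jy].
rewrite -{1}(setD1K jN) setUC; apply: cond_indep_intersection => //.
- by rewrite in_setD jN.
- by rewrite setD11.
- have -> : before :\: N :|: N :\ j = before :\ j.
    apply/setP => x; rewrite !in_setU !in_setD !in_set1.
    have [xN|xN] := boolP (x \in N); last first.
      have xj : x != j by apply: contraNneq xN => ->.
      by rewrite xj andbF orbF.
    by have := subsetP subN x xN; rewrite in_setD => /andP[_ ->]; rewrite andbT.
  apply: (sg_sym (cond_indep_semi_graphoid P)); apply: contrapT => dep.
  move/negP: nonpar; apply; rewrite inE; apply/perm_dag_arcP; split=> //.
  by move: jy; rewrite inE.
- have -> : before :\: N :|: [set j] = before :\: (N :\ j).
    apply/setP => x; rewrite !in_setU !in_setD !in_set1.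
    by have [->|] := eqVneq x j; rewrite /= ?orbF // jy orbT.
  apply: IHn; last exact: subset_trans (subsetDl _ _) subN.
  by move: Nn; rewrite (cardsD1 j) jN.
Qed.

(** With all the nonparents for [N], [perm_dag_nonparents] is the local property
    required by [global_markov]. *)
Lemma perm_dag_markov pi : markov_to (perm_dag P pi) P.
Proof.
have increasing x y : arc_in (perm_dag P pi) x y -> position pi x < position pi y.
  by case/perm_dag_arcP.
move=> A B S [_ dAS dBS].
apply: (global_markov (@position_inj pi) increasing (cond_indep_semi_graphoid P)) => // y.
have {2}-> : parents (perm_dag P pi) y =
    initial (position pi) (position pi y) :\:
      (initial (position pi) (position pi y) :\: parents (perm_dag P pi) y).
  rewrite setDDr setDv set0U; apply/esym/setIidPr/subsetP => x; rewrite !inE.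
  exact: increasing.
exact: perm_dag_nonparents.
Qed.

End PermutationDags.

(** * Sparsest permutations *)

Section SparsestPermutation.
Context (R : realType) (p : nat) (d : 'I_p -> measure_display).
Context (T : forall i, measurableType (d i)) (P : probability (joint_space T) R).

Lemma dag_eq (G H : dag p) : edges G = edges H -> G = H.
Proof.
case: G H => [E acE] [E' acE'] /= eqE; subst E'.
by congr Dag; exact: Prop_irrelevance.
Qed.

(** Take a topological order of [G]: the arcs of its permutation DAG are among those
    of [G], so that equally many arcs are the same arcs. *)
Lemma markov_perm_dag_le (G : dag p) : markov_to G P ->
  exists2 pi : {perm 'I_p}, nb_edges (perm_dag P pi) <= nb_edges G
    & nb_edges G <= nb_edges (perm_dag P pi) -> perm_dag P pi = G.
Proof.
move=> markovG; have [pi piG] := topological_perm G.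
have sub := perm_dag_sub_markov markovG piG.
exists pi; first exact: subset_leq_card.
by move=> le_card; apply/dag_eq/eqP; rewrite finset.eqEcard sub.
Qed.

Lemma sp_output_exists : exists2 G, sp_output P G &
  forall pi, nb_edges G <= nb_edges (perm_dag P pi).
Proof.
case: (@arg_minnP _ (1%g : {perm 'I_p}) xpredT
  (fun pi => nb_edges (perm_dag P pi)) isT) => pi _ min_pi.
by exists (perm_dag P pi) => [|pi']; [exists pi => // pi'|]; exact: min_pi.
Qed.

End SparsestPermutation.

Theorem theorem2p3 (R : realType) (p : nat) (hp : (1 <= p)%N)
    (d : 'I_p -> measure_display) (T : forall i, measurableType (d i))
    (P : probability (joint_space T) R) (hP : positive_measure P)
    (Gstar : dag p) (hG : markov_to Gstar P) :
  (forall GSP : dag p, sp_output P GSP -> markov_class Gstar GSP) <->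
  SMR Gstar P.
Proof.
split=> [sp_sound|[_ smr] G [pi min_pi <-]].
- split=> // G markovG notG.
  have [GSP spGSP min_GSP] := sp_output_exists P.
  have eq_star : nb_edges Gstar = nb_edges GSP.
    exact/markov_equivalent_nb_edges/sp_sound.
  have [pi le_piG eq_piG] := markov_perm_dag_le markovG.
  rewrite ltnNge; apply/negP => le_Gstar; apply: notG; apply: sp_sound.
  (* no Markov DAG beats an output, so [G] has minimal size and is an output *)
  have {}le_Gstar : nb_edges G <= nb_edges GSP by rewrite -eq_star.
  exists pi => [pi'|].
    exact: leq_trans le_piG (leq_trans le_Gstar (min_GSP pi')).
  exact: eq_piG (leq_trans le_Gstar (min_GSP pi)).
- have [pi' le_star _] := markov_perm_dag_le hG.
  apply: contrapT => /(smr _ (@perm_dag_markov _ _ _ _ _ hP pi)).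
  by rewrite ltnNge (leq_trans (min_pi pi') le_star).
Qed.
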